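(* Let $S$ be a numerical semigroup. The following statements hold: (1) $S$ is almost symmetric if and only if $n+\mathrm{F}(S)-f\in S$ for all $f\in\mathrm{PF}(S)$ and all $n\in\mathrm{G}(S)$; (2) $S$ is nearly Gorenstein if and only if for every $n_i\in\mathrm{G}(S)$ there exists $f_i\in\mathrm{PF}(S)$ such that $n_i+f_i-f\in S$ for all $f\in\mathrm{PF}(S)$. In particular, an almost symmetric numerical semigroup is nearly Gorenstein.
   Context: A numerical semigroup is a submonoid $S$ of $\mathbb{N}=\{0,1,2,\dots\}$ with $\mathbb{N}\setminus S$ finite. Every numerical semigroup has a unique minimal set of generators, denoted $\mathrm{G}(S)$, which is finite. $\mathrm{F}(S)=\max(\mathbb{Z}\setminus S)$ is the Frobenius number. $\mathrm{PF}(S)=\{f\in\mathbb{Z}\setminus S : f+s\in S \text{ for all } s\in S\setminus\{0\}\}$ is the set of pseudo-Frobenius numbers. Put $M(S)=S\setminus\{0\}$, $K(S)=\{z\in\mathbb{Z} : \mathrm{F}(S)-z\notin S\}$, and $S-K(S)=\{z\in\mathbb{Z} : z+K(S)\subseteq S\}$. $S$ is almost symmetric if $M(S)+K(S)=M(S)$, and nearly Gorenstein if $M(S)\subseteq K(S)+(S-K(S))$. *)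

(* Defs.v *)
From mathcomp Require Import all_boot all_order all_algebra.
From mathcomp Require Import all_classical.
From mathcomp Require Import zify.

Set Implicit Arguments.
Unset Strict Implicit.
Unset Printing Implicit Defensive.

Import Order.TTheory GRing.Theory Num.Theory.

Local Open Scope classical_set_scope.
Local Open Scope ring_scope.

Definition submonoid (A : set nat) : Prop :=
  A 0%N /\ forall m n, A m -> A n -> A (m + n)%N.

Definition numerical_semigroup (S : set nat) : Prop :=
  submonoid S /\ finite_set (~` S).

Definition generates (A S : set nat) : Prop := smallest submonoid A = S.

Definition minimal_generating_set (S A : set nat) : Prop :=
  generates A S /\ forall B, B `<=` A -> generates B S -> B = A.

(* The default value set0 plays no role for a submonoid S:
   see min_generatorsP and min_generators_unique. *)
Definition min_generators (S : set nat) : set nat :=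
  xget set0 [set A | minimal_generating_set S A].

Definition int_set (S : set nat) : set int := Posz @` S.

Definition is_max (A : set int) (m : int) : Prop := A m /\ ubound A m.

(* The default value 0 plays no role for a numerical semigroup S:
   see FrobeniusP. *)
Definition Frobenius (S : set nat) : int :=
  xget 0 [set f | is_max (~` int_set S) f].

Definition pseudo_Frobenius (S : set nat) : set int :=
  [set f | ~ int_set S f /\
           forall s, (int_set S `\ 0) s -> int_set S (f + s)].

Definition set_sum (A B : set int) : set int :=
  [set a + b | a in A & b in B].

Definition maximal_ideal (S : set nat) : set int := int_set S `\ 0.

Definition canonical_ideal (S : set nat) : set int :=
  [set z | ~ int_set S (Frobenius S - z)].

Definition dual_canonical (S : set nat) : set int :=
  [set z | set_sum [set z] (canonical_ideal S) `<=` int_set S].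

Definition almost_symmetric (S : set nat) : Prop :=
  set_sum (maximal_ideal S) (canonical_ideal S) = maximal_ideal S.

Definition nearly_Gorenstein (S : set nat) : Prop :=
  maximal_ideal S `<=` set_sum (canonical_ideal S) (dual_canonical S).

Lemma int_setE (S : set nat) (n : nat) : int_set S n%:Z <-> S n.
Proof.
by split=> [[m Sm [<-]] //|Sn]; exists n.
Qed.

Lemma is_max_unique (A : set int) (m n : int) :
  is_max A m -> is_max A n -> m = n.
Proof.
move=> [Am um] [An un]; apply/eqP; rewrite eq_le.
by rewrite (un _ Am) (um _ An).
Qed.

Lemma FrobeniusP (S : set nat) :
  numerical_semigroup S -> is_max (~` int_set S) (Frobenius S).
Proof.
move=> [_ finS]; apply: (@xgetPex _ 0 [set f | is_max (~` int_set S) f]).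
have [b gapb] : exists b : nat, forall n, ~ S n -> (n < b)%N.
  have /finite_seqP[s Es] := finS.
  exists (\max_(i <- s) i).+1 => n nS; rewrite ltnS.
  have ns : n \in s by have : (~` S) n := nS; rewrite Es.
  exact: (leq_bigmax_seq (F := id)).
elim: b gapb => [|b IHb] gapb.
  exists (-1); split=> [[n _] //|z nSz].
  case: z nSz => [n|n _]; last by lia.
  by move=> nSn; have /gapb : ~ S n by move=> Sn; apply: nSn; exists n.
have [Sb|nSb] := pselect (S b).
  apply: IHb => n nSn; have := gapb _ nSn; rewrite ltnS leq_eqVlt.
  by case/orP=> // /eqP nb; case: nSn; rewrite nb.
exists b%:Z; split=> [/int_setE //|z nSz].
case: z nSz => [n|n _]; last by lia.
move=> nSn; have /gapb : ~ S n by move=> Sn; apply: nSn; exists n.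
by lia.
Qed.

Lemma submonoid_smallest (A : set nat) : submonoid (smallest submonoid A).
Proof.
split=> [M [[M0 _] _] //|m n Am An M sM].
by case: (sM) => -[_ MD] _; apply: MD; [exact: Am|exact: An].
Qed.

Definition indecomposables (S : set nat) : set nat :=
  [set a | [/\ S a, a != 0%N &
    forall m n, S m -> S n -> a = (m + n)%N -> m = 0%N \/ n = 0%N]].

Lemma indecomposables_sub (S B : set nat) :
  submonoid S -> generates B S -> indecomposables S `<=` B.
Proof.
move=> [S0 SD] gB a [Sa a0 ia]; apply: contrapT => nBa.
have sBS : B `<=` S by rewrite -gB; exact: sub_gen_smallest.
have : (S `\ a) a; last by case=> _; apply.
have /smallest_sub : submonoid (S `\ a).
  split; first by split=> //= a0'; rewrite -a0' eqxx in a0.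
  move=> m n [Sm /= ma] [Sn /= na]; split; first exact: SD.
  move=> /= mna; have [m0|n0] := ia _ _ Sm Sn (esym mna).
    by apply: na; rewrite -mna m0.
  by apply: ma; rewrite -mna n0 addn0.
move=> /(_ B) sub; move: Sa; rewrite -{1}gB; apply: sub.
by move=> b Bb; split; [exact: sBS|move=> /= ba; apply: nBa; rewrite -ba].
Qed.

Lemma indecomposables_generates (S : set nat) :
  submonoid S -> generates (indecomposables S) S.
Proof.
move=> sS; have [S0 SD] := sS; rewrite /generates eqEsubset; split.
  by apply: smallest_sub => // a [].
move=> n; elim/ltn_ind: n => n IHn Sn.
have [T0 TD] := submonoid_smallest (indecomposables S).
have [->//|n0] := eqVneq n 0%N.
have [?|nin] := pselect (indecomposables S n); first exact: sub_gen_smallest.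
apply: contrapT => nTn; apply: nin; split=> // p q Sp Sq npq.
have [p0|p0] := eqVneq p 0%N; first by left.
have [q0|q0] := eqVneq q 0%N; first by right.
by case: nTn; rewrite npq; apply: TD; apply: IHn => //; lia.
Qed.

Lemma min_generators_unique (S A B : set nat) : submonoid S ->
  minimal_generating_set S A -> minimal_generating_set S B -> A = B.
Proof.
move=> sS.
suff eqI C : minimal_generating_set S C -> indecomposables S = C.
  by move=> /eqI <- /eqI.
move=> [gC]; apply; first exact: indecomposables_sub.
exact: indecomposables_generates.
Qed.

Lemma min_generatorsP (S : set nat) :
  submonoid S -> minimal_generating_set S (min_generators S).
Proof.
move=> sS; apply: (@xgetPex _ set0 [set A | minimal_generating_set S A]).
exists (indecomposables S); split; first exact: indecomposables_generates.
move=> B sB gB; rewrite eqEsubset; split=> //.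
exact: indecomposables_sub.
Qed.

(* Main.v *)
(** Every gap [z] lies below some pseudo-Frobenius number [f], in the sense that
    [f - z] is in [S]: take for [f] the largest gap in [z + S]. Hence the
    canonical ideal [K] is the union of the translates [F - f + S] for [f] in
    [PF], so [d + K] is contained in [S] iff [d + F - f] is in [S] for every [f]
    in [PF]. Since [K + S] is contained in [K], both properties need only be
    tested on generators; (2) comes from writing [n = (F - f + s) + d] and moving
    [s] from [K] to [S - K], and (1) implies (2) by the choice [f_i = F]. *)
Require Import Defs.
From mathcomp Require Import all_boot all_order all_algebra.
From mathcomp Require Import all_classical.
From mathcomp Require Import zify.

Set Implicit Arguments.
Unset Strict Implicit.
Unset Printing Implicit Defensive.

Local Open Scope classical_set_scope.
Local Open Scope ring_scope.

Import Order.TTheory GRing.Theory Num.Theory.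

(** Indecomposables generate [S] and lie in every generating set, so minimality forces equality. *)
Lemma min_generatorsE (S : set nat) :
  submonoid S -> min_generators S = indecomposables S.
Proof.
move=> sS; have [gG minG] := min_generatorsP sS.
apply/esym/minG; first exact: indecomposables_sub.
exact: indecomposables_generates.
Qed.

Lemma min_generators_decomp (S : set nat) (m : nat) : submonoid S -> S m ->
  m != 0%N -> exists n s, [/\ min_generators S n, S s & m = (n + s)%N].
Proof.
move=> sS Sm m0; have [S0 SD] := sS.
(* [T] is a submonoid containing every generator, hence all of [S]. The guard [m != 0] admits the
   neutral element. *)
pose T : set nat := [set m | S m /\
  (m != 0%N -> exists n s, [/\ min_generators S n, S s & m = (n + s)%N])].
suff : T m by case=> _; apply.
have sT : submonoid T.
  split=> [|p q [Sp dp] [Sq dq]]; first by split.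
  split=> [|pq0]; first exact: SD.
  have [p0|/dp[n [s [Gn Ss ps]]]] := eqVneq p 0%N.
    by rewrite p0 add0n in pq0 *; exact: dq.
  by exists n, (s + q)%N; split=> //; [exact: SD|rewrite ps addnA].
have [gG _] := min_generatorsP sS.
move: Sm; rewrite -{1}gG; apply: smallest_sub => // n Gn.
split; first by rewrite -gG; exact: sub_gen_smallest.
by move=> _; exists n, 0%N; split=> //; rewrite addn0.
Qed.

Section NumericalSemigroup.
Variables (S : set nat) (hS : numerical_semigroup S).

Local Notation F := (Frobenius S).
Local Notation PF := (pseudo_Frobenius S).
Local Notation K := (canonical_ideal S).

Let sS : submonoid S := proj1 hS.

Lemma int_set0 : int_set S 0.
Proof. by exists 0%N => //; case: sS. Qed.

Lemma int_setD (x y : int) : int_set S x -> int_set S y -> int_set S (x + y).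
Proof.
move=> [m Sm <-] [n Sn <-]; exists (m + n)%N => //.
by case: sS => _; apply.
Qed.

Lemma Frobenius_notin : ~ int_set S F.
Proof. by case: (FrobeniusP hS). Qed.

Lemma gt_Frobenius (x : int) : F < x -> int_set S x.
Proof.
move=> Fx; apply: contrapT => nSx.
by have [_ /(_ _ nSx)] := FrobeniusP hS; rewrite leNgt Fx.
Qed.

Lemma Frobenius_pseudo : PF F.
Proof.
split=> [|s [[n _ <-] /= n0]]; first exact: Frobenius_notin.
by apply: gt_Frobenius; lia.
Qed.

Lemma notin_int_setP (z : int) :
  ~ int_set S z <-> exists2 f, PF f & int_set S (f - z).
Proof.
split=> [|[f [nSf _] Sfz] Sz]; last first.
  by apply: nSf; rewrite -(subrK z f); exact: int_setD.
(* Induction on a bound [k] for the distance from [z] to [F]: a gap outside [PF] can be moved up by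
   some nonzero [s] in [S] to another gap, still at most [F] and so strictly closer to it. *)
move: {2}(absz (F - z)) (leqnn (absz (F - z))) => k.
elim: k z => [|k IHk] z zk nSz.
  have -> : z = F by lia.
  by exists F; [exact: Frobenius_pseudo|rewrite subrr; exact: int_set0].
have zF : z <= F by rewrite leNgt; apply/negP => /gt_Frobenius.
have [PFz|nPFz] := pselect (PF z).
  by exists z => //; rewrite subrr; exact: int_set0.
have [s [Ss s0 nSzs]] : exists s, [/\ int_set S s, s != 0 & ~ int_set S (z + s)].
  apply: contrapT => nex; apply: nPFz; split=> // s [Ss /eqP s0].
  by apply: contrapT => nSzs; apply: nex; exists s.
have zsF : z + s <= F by rewrite leNgt; apply/negP => /gt_Frobenius.
have [||f PFf Sf] := IHk (z + s) => //.
  by case: Ss => m _ ms; lia.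
exists f => //; have -> : f - z = (f - (z + s)) + s by lia.
exact: int_setD.
Qed.

(** Apply [notin_int_setP] to the gap [F - z] and use [f - (F - z) = z - (F - f)]. *)
Lemma canonicalP (z : int) :
  K z <-> exists2 f, PF f & int_set S (z - (F - f)).
Proof.
by split=> [/notin_int_setP[f PFf Sf]|[f PFf Sf]];
  [exists f => //|apply/notin_int_setP; exists f => //];
  move: Sf; congr (int_set S _); lia.
Qed.

Lemma canonical_pseudo (f : int) : PF f -> K (F - f).
Proof.
by move=> PFf; apply/canonicalP; exists f => //; rewrite subrr; exact: int_set0.
Qed.

Lemma canonicalD (z s : int) : K z -> int_set S s -> K (z + s).
Proof.
move=> /canonicalP[f PFf Sf] Ss; apply/canonicalP; exists f => //.
by rewrite addrAC; exact: int_setD.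
Qed.

Lemma dual_canonicalP (d : int) :
  dual_canonical S d <-> forall f, PF f -> int_set S (d + F - f).
Proof.
split=> [dK f PFf|dPF _ [_ -> [z /canonicalP[f PFf Sf] <-]]].
  apply: dK; exists d => //; exists (F - f); first exact: canonical_pseudo.
  by rewrite addrA.
have -> : d + z = (d + F - f) + (z - (F - f)) by lia.
by apply: int_setD => //; exact: dPF.
Qed.

Lemma dual_canonicalD (d s : int) :
  dual_canonical S d -> int_set S s -> dual_canonical S (d + s).
Proof.
move=> /dual_canonicalP dPF Ss; apply/dual_canonicalP => f /dPF Sf.
have -> : d + s + F - f = d + F - f + s by lia.
exact: int_setD.
Qed.

Lemma min_generators_maximal (n : nat) :
  min_generators S n -> maximal_ideal S n%:Z.
Proof.
rewrite min_generatorsE// => -[Sn n0 _].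
by split; [exists n|move=> /= n0'; lia].
Qed.

(** This reduces conditions on all of [M] to conditions on generators, the summand [s] being
    absorbed by [canonicalD] or [dual_canonicalD]. *)
Lemma maximal_decomp (m : int) : maximal_ideal S m ->
  exists n s, [/\ min_generators S n, int_set S s & m = n%:Z + s].
Proof.
move=> [[k Sk <-] /= k0].
have [|n [s [Gn Ss ->]]] := min_generators_decomp sS Sk; first by lia.
by exists n, s%:Z; split=> //; exists s.
Qed.

(** Since [0] is in [K], [M] always lies in [M + K]; only the inclusion of [M + K] in [M] is at
    stake. *)
Lemma almost_symmetric_dualP :
  almost_symmetric S <-> maximal_ideal S `<=` dual_canonical S.
Proof.
split=> [aS m Mm _ [_ -> [z Kz <-]]|MK].
  have : set_sum (maximal_ideal S) K (m + z) by exists m => //; exists z.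
  by rewrite aS; case.
rewrite /almost_symmetric eqEsubset; split=> [_ [m Mm [z Kz <-]]|m Mm].
  split; first by apply: (MK _ Mm); exists m => //; exists z.
  (* If [m + z = 0], then [F - z = F + m] exceeds [F] and lies in [S], contrary to [z] in [K]. *)
  move=> /= mz0; apply: Kz; apply: gt_Frobenius.
  by case: Mm => -[k _ <-] /= k0 in mz0 *; lia.
exists m => //; exists 0; last by rewrite addr0.
by rewrite /canonical_ideal /= subr0; exact: Frobenius_notin.
Qed.

Lemma almost_symmetricP : almost_symmetric S <->
  forall (f : int) (n : nat), PF f -> min_generators S n ->
    int_set S (n%:Z + F - f).
Proof.
rewrite almost_symmetric_dualP; split=> [MK f n PFf|GPF m].
  by move=> /min_generators_maximal/MK/dual_canonicalP; exact.
move=> /maximal_decomp[n [s [Gn Ss ->]]]; apply: dual_canonicalD => //.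
by apply/dual_canonicalP => f PFf; exact: GPF.
Qed.

Lemma nearly_GorensteinP : nearly_Gorenstein S <->
  forall ni : nat, min_generators S ni ->
    exists fi : int, PF fi /\
      forall f : int, PF f -> int_set S (ni%:Z + fi - f).
Proof.
split=> [nG n /min_generators_maximal/nG[z /canonicalP[g PFg Sg] [d dK zd]]|GPF].
  (* With [s = z - (F - g)] in [S], the sum [d + s] stays in [S - K], and
     [d + s + F - f = n + g - f]. *)
  exists g; split=> // f PFf.
  have /dual_canonicalP/(_ f PFf) := dual_canonicalD dK Sg.
  by congr (int_set S _); lia.
move=> _ /maximal_decomp[n [s [/GPF[g [PFg gP]] Ss ->]]].
(* Split [n + s] as [(F - g + s) + (n + g - F)]; the choice of [g] says exactly that the second term
   is in [S - K]. *)
exists (F - g + s); first by apply: canonicalD => //; exact: canonical_pseudo.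
exists (n%:Z + g - F); last by lia.
by apply/dual_canonicalP => f /gP; congr (int_set S _); lia.
Qed.

End NumericalSemigroup.

Theorem proposition1p1 (S : set nat) (hS : numerical_semigroup S) :
  [/\ almost_symmetric S <->
        (forall (f : int) (n : nat),
           pseudo_Frobenius S f -> min_generators S n ->
           int_set S (n%:Z + Frobenius S - f)),
      nearly_Gorenstein S <->
        (forall ni : nat, min_generators S ni ->
           exists fi : int, pseudo_Frobenius S fi /\
             forall f : int, pseudo_Frobenius S f ->
               int_set S (ni%:Z + fi - f))
    & almost_symmetric S -> nearly_Gorenstein S].
Proof.
split; [exact: almost_symmetricP|exact: nearly_GorensteinP|].
move=> /(almost_symmetricP hS) aS; apply/nearly_GorensteinP => // n Gn.
exists (Frobenius S); split=> [|f PFf]; first exact: Frobenius_pseudo.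
exact: aS.
Qed.
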